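(* Let $n\ge 3$, let $t_1<t_2<\cdots<t_n$ be real numbers, let $f_1,\dots,f_n$ be real data values with $f_i>0$ for all $i\in\{1,\dots,n\}$, let $d_1,\dots,d_n\in\mathbb{R}$ be the derivative values at the knots, and let $\epsilon=(\epsilon_1,\dots,\epsilon_{n-1})\in\{0,1\}^{n-1}$ be a signature. Put $l=t_n-t_1$ and, for $j\in\{1,\dots,n-1\}$, $a_j=\dfrac{t_{j+1-\epsilon_j}-t_{j+\epsilon_j}}{t_n-t_1}$. Let $\phi_\epsilon$ be the rational cubic trigonometric zipper fractal interpolation function (RCTZFIF, as defined in the context) that interpolates $\{(t_i,f_i)\}_{i=1}^n$ with signature $\epsilon$, derivative values $d_i$, scaling factors $\lambda_j$ and shape parameters $\alpha_{j,\epsilon},\beta_{j,\epsilon},\gamma_{j,\epsilon},\delta_{j,\epsilon}$ ($j\in\{1,\dots,n-1\}$). Suppose that for every $j\in\{1,\dots,n-1\}$: 1. the scaling factors satisfy $$0\le\lambda_j<\min\left\{|a_j|,\ \frac{f_{j+\epsilon_j}}{f_1},\ \frac{f_{j+1-\epsilon_j}}{f_n}\right\};$$ 2. the shape parameters satisfy $\alpha_{j,\epsilon}>0$, $\delta_{j,\epsilon}>0$, $$\beta_{j,\epsilon}>\max\left\{0,\ \frac{-2l\,\alpha_{j,\epsilon}\,d_{j,\epsilon}^*}{\pi f_{j,\epsilon}^*}\right\},\qquad \gamma_{j,\epsilon}>\max\left\{0,\ \frac{2l\,\delta_{j,\epsilon}\,d_{j+1,\epsilon}^*}{\pi f_{j+1,\epsilon}^*}\right\},$$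 where, for the given index $j$, $f_{j,\epsilon}^*=f_{j+\epsilon_j}-\lambda_jf_1$, $f_{j+1,\epsilon}^*=f_{j+1-\epsilon_j}-\lambda_jf_n$, $d_{j,\epsilon}^*=a_jd_{j+\epsilon_j}-\lambda_jd_1$, $d_{j+1,\epsilon}^*=a_jd_{j+1-\epsilon_j}-\lambda_jd_n$. Then $\phi_\epsilon$ preserves the positivity of the data, i.e. $\phi_\epsilon(t)>0$ for all $t\in[t_1,t_n]$.
   Context: Definition of the RCTZFIF. Let $I=[t_1,t_n]$, $I_j=[t_j,t_{j+1}]$, $l=t_n-t_1$. For a signature $\epsilon\in\{0,1\}^{n-1}$ and $j\in\{1,\dots,n-1\}$, let $L_j:I\to I_j$ be the affine map $L_j(t)=a_jt+b_j$ with $$a_j=\frac{t_{j+1-\epsilon_j}-t_{j+\epsilon_j}}{t_n-t_1},\qquad b_j=\frac{t_nt_{j+\epsilon_j}-t_1t_{j+1-\epsilon_j}}{t_n-t_1},$$ so that $L_j(t_1)=t_{j+\epsilon_j}$ and $L_j(t_n)=t_{j+1-\epsilon_j}$ (thus $a_j<0$ when $\epsilon_j=1$). The scaling factors are real numbers $\lambda_j$ with $|\lambda_j|<|a_j|$. For $t\in I$ put $\theta=\frac{\pi}{2}\cdot\frac{t-t_1}{t_n-t_1}\in[0,\pi/2]$ and $M_{j,\epsilon}(t)=\dfrac{p_{j,\epsilon}(\theta)}{q_{j,\epsilon}(\theta)}$, where $$p_{j,\epsilon}(\theta)=(1-\sin\theta)^3U_{j,\epsilon}+\sin\theta(1-\sin\theta)^2V_{j,\epsilon}+\cos\theta(1-\cos\theta)^2W_{j,\epsilon}+(1-\cos\theta)^3X_{j,\epsilon},$$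 $$q_{j,\epsilon}(\theta)=(1-\sin\theta)^3\alpha_{j,\epsilon}+\sin\theta(1-\sin\theta)^2\beta_{j,\epsilon}+\cos\theta(1-\cos\theta)^2\gamma_{j,\epsilon}+(1-\cos\theta)^3\delta_{j,\epsilon},$$ the real numbers $\alpha_{j,\epsilon},\beta_{j,\epsilon},\gamma_{j,\epsilon},\delta_{j,\epsilon}$ being the shape parameters (chosen so that $q_{j,\epsilon}\neq0$ on $[0,\pi/2]$), and $$U_{j,\epsilon}=\alpha_{j,\epsilon}(f_{j+\epsilon_j}-\lambda_jf_1),\qquad X_{j,\epsilon}=\delta_{j,\epsilon}(f_{j+1-\epsilon_j}-\lambda_jf_n),$$ $$V_{j,\epsilon}=\beta_{j,\epsilon}(f_{j+\epsilon_j}-\lambda_jf_1)+\frac{2l\,\alpha_{j,\epsilon}(a_jd_{j+\epsilon_j}-\lambda_jd_1)}{\pi},$$ $$W_{j,\epsilon}=\gamma_{j,\epsilon}(f_{j+1-\epsilon_j}-\lambda_jf_n)-\frac{2l\,\delta_{j,\epsilon}(a_jd_{j+1-\epsilon_j}-\lambda_jd_n)}{\pi}.$$ The RCTZFIF $\phi_\epsilon:I\to\mathbb{R}$ is the unique continuous function with $\phi_\epsilon(t_1)=f_1$, $\phi_\epsilon(t_n)=f_n$ satisfying $$\phi_\epsilon(L_j(t))=\lambda_j\phi_\epsilon(t)+M_{j,\epsilon}(t),\qquad t\in I,\ j\in\{1,\dots,n-1\}.$$ Equivalently, it is the fixed point of the operator $(Th)(t)=\lambda_jh(L_j^{-1}(t))+M_{j,\epsilon}(L_j^{-1}(t))$,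 $t\in I_j$, on the space of continuous functions $h:I\to\mathbb{R}$ with $h(t_1)=f_1$, $h(t_n)=f_n$. It is a $\mathcal{C}^1$ function with $\phi_\epsilon(t_i)=f_i$ and $\phi_\epsilon'(t_i)=d_i$ for all $i$. *)

(* Defs.v *)
From HB Require Import structures.
From mathcomp Require Import all_boot all_order all_algebra.
From mathcomp Require Import all_classical all_reals all_analysis.

Set Implicit Arguments.
Unset Strict Implicit.
Unset Printing Implicit Defensive.

Import Order.TTheory GRing.Theory Num.Theory.
Import numFieldNormedType.Exports.

Local Open Scope classical_set_scope.
Local Open Scope ring_scope.

(* Knots t_1 < ... < t_n, values f_i and slopes d_i are families indexed by
   nat of which only the entries 1 <= i <= n are used; the signature eps, the
   scaling factors lam and the shape parameters are used at 1 <= j <= n - 1.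
   The signature bit eps j : bool is read as 0 or 1 inside indices, so that
   j + eps j and j + 1 - eps j are the two endpoints of the j-th interval. *)
Section RCTZFIF.
Context {R : realType}.
Variables (n : nat) (t f d : nat -> R) (eps : nat -> bool) (lam : nat -> R).
Variables (alpha beta gamma delta : nat -> R).

Definition total_length : R := t n - t 1%N.

Definition slope (j : nat) : R :=
  (t (j + 1 - eps j)%N - t (j + eps j)%N) / (t n - t 1%N).

Definition intercept (j : nat) : R :=
  (t n * t (j + eps j)%N - t 1%N * t (j + 1 - eps j)%N) / (t n - t 1%N).

Definition zipper_map (j : nat) (x : R) : R := slope j * x + intercept j.

Definition U_coef (j : nat) : R :=
  alpha j * (f (j + eps j)%N - lam j * f 1%N).

Definition V_coef (j : nat) : R :=
  beta j * (f (j + eps j)%N - lam j * f 1%N)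
  + 2 * total_length * alpha j
      * (slope j * d (j + eps j)%N - lam j * d 1%N) / pi.

Definition W_coef (j : nat) : R :=
  gamma j * (f (j + 1 - eps j)%N - lam j * f n)
  - 2 * total_length * delta j
      * (slope j * d (j + 1 - eps j)%N - lam j * d n) / pi.

Definition X_coef (j : nat) : R :=
  delta j * (f (j + 1 - eps j)%N - lam j * f n).

Definition trig_cubic (c0 c1 c2 c3 theta : R) : R :=
  (1 - sin theta) ^+ 3 * c0
  + sin theta * (1 - sin theta) ^+ 2 * c1
  + cos theta * (1 - cos theta) ^+ 2 * c2
  + (1 - cos theta) ^+ 3 * c3.

Definition angle (x : R) : R := pi / 2 * ((x - t 1%N) / (t n - t 1%N)).

Definition rational_part (j : nat) (x : R) : R :=
  trig_cubic (U_coef j) (V_coef j) (W_coef j) (X_coef j) (angle x)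
  / trig_cubic (alpha j) (beta j) (gamma j) (delta j) (angle x).

(* Only the restriction of phi to [t_1, t_n] is constrained. For increasing knots, when
   |lam j| < |slope j| for all j and the denominators of the rational parts do
   not vanish, this restriction exists and is unique: it is the fixed point of
   the associated Read-Bajraktarevic contraction. *)
Definition is_RCTZFIF (phi : R -> R) : Prop :=
  [/\ {within `[t 1%N, t n], continuous phi},
      phi (t 1%N) = f 1%N,
      phi (t n) = f n
    & forall (j : nat) (x : R), (1 <= j < n)%N -> t 1%N <= x <= t n ->
        phi (zipper_map j x) = lam j * phi x + rational_part j x].

End RCTZFIF.

(* Main.v *)
Require Import Defs.
From HB Require Import structures.
From mathcomp Require Import all_boot all_order all_algebra.
From mathcomp Require Import all_classical all_reals all_analysis.
From mathcomp Require Import ring lra.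
Import Order.TTheory GRing.Theory Num.Theory.
Import numFieldNormedType.Exports.
Local Open Scope ring_scope.

(* Every coefficient of the numerators and of the denominators is positive, so
   each rational part M_j is positive on [t_1, t_n].  At a minimiser x = L_j(y)
   of phi, phi x = lam_j phi y + M_j y > lam_j phi x, and lam_j < |a_j| <= 1
   forces phi x > 0. *)

(** On the first quadrant [sin] and [cos] lie in [0, 1], so all four terms are nonnegative. The [c0]
    term is positive unless [sin theta = 1]; in that case [cos theta = 0] and the sum reduces to
    [c3]. *)
Lemma trig_cubic_gt0 (R : realType) (c0 c1 c2 c3 theta : R) :
  0 < c0 -> 0 < c1 -> 0 < c2 -> 0 < c3 -> 0 <= theta <= pi / 2 ->
  0 < trig_cubic c0 c1 c2 c3 theta.
Proof.
move=> c0_gt0 c1_gt0 c2_gt0 c3_gt0 /andP[theta_ge0 theta_le].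
have pi_gt0 := pi_gt0 R.
have s_ge0 : 0 <= sin theta by apply: sin_ge0_pi; apply/andP; split; lra.
have c_ge0 : 0 <= cos theta by apply: cos_ge0_pihalf; apply/andP; split; lra.
have s_le1 := sin_le1 theta; have c_le1 := cos_le1 theta.
have sc := cos2Dsin2 theta.
rewrite /trig_cubic; move: (sin theta) (cos theta) s_ge0 c_ge0 s_le1 c_le1 sc.
move=> s c s_ge0 c_ge0 s_le1 c_le1 sc.
have t1_ge0 : 0 <= s * (1 - s) ^+ 2 * c1.
  by rewrite !mulr_ge0 ?exprn_ge0 ?subr_ge0 // ltW.
have t2_ge0 : 0 <= c * (1 - c) ^+ 2 * c2.
  by rewrite !mulr_ge0 ?exprn_ge0 ?subr_ge0 // ltW.
have t3_ge0 : 0 <= (1 - c) ^+ 3 * c3.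
  by rewrite mulr_ge0 ?exprn_ge0 ?subr_ge0 // ltW.
have [s1|s_neq1] := eqVneq s 1.
  have c_eq0 : c = 0.
    by apply/eqP; rewrite -sqrf_eq0; apply/eqP; rewrite s1 in sc; lra.
  by rewrite s1 c_eq0 !(subrr, subr0, mul0r, expr1n, expr0n) /=; lra.
have t0_gt0 : 0 < (1 - s) ^+ 3 * c0.
  by rewrite mulr_gt0 // exprn_gt0 // subr_gt0 lt_neqAle s_neq1.
lra.
Qed.

Lemma knots_le (R : realType) (n : nat) (t : nat -> R) :
  (forall i, (1 <= i < n)%N -> t i < t i.+1) ->
  forall i j, (1 <= i)%N -> (i <= j <= n)%N -> t i <= t j.
Proof.
move=> t_incr i j i_ge1; elim: j => [|j IH] /andP[ij jn].
  by move: ij; rewrite leqn0 => /eqP->.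
move: ij; rewrite leq_eqVlt => /predU1P[->//|]; rewrite ltnS => ij.
apply: (le_trans (IH _)); first by rewrite ij ltnW.
by rewrite ltW // t_incr // (leq_trans i_ge1 ij).
Qed.

(** Induction on the number of knots: a point beyond the last but one knot lies in the last
    interval, and any other point is covered by the induction hypothesis. *)
Lemma knot_interval (R : realType) (n : nat) (t : nat -> R) (x : R) :
  (1 < n)%N -> t 1%N <= x <= t n ->
  exists2 j, (1 <= j < n)%N & t j <= x <= t j.+1.
Proof.
elim: n => // n IH; rewrite ltnS leq_eqVlt => /predU1P[<- ?|n_gt1].
  by exists 1%N.
move=> /andP[x_ge x_le]; have [x_len|x_gtn] := leP x (t n).
  have [|j /andP[j_ge1 jn] xj] := IH n_gt1; first by rewrite x_ge.
  by exists j; rewrite // j_ge1 ltnW.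
by exists n; rewrite ?(ltnW n_gt1) ?ltnSn // ltW.
Qed.

Section Positivity.
Variables (R : realType) (n : nat) (t : nat -> R) (eps : nat -> bool).
Hypothesis t_lt : t 1%N < t n.

Lemma zipper_map_onto (j : nat) (x : R) :
  t j < t j.+1 -> t j <= x <= t j.+1 ->
  exists2 y, t 1%N <= y <= t n & x = zipper_map n t eps j y.
Proof.
move=> tj /andP[x_ge x_le].
have l_gt0 : 0 < t n - t 1%N by rewrite subr_gt0.
have h_gt0 : 0 < t j.+1 - t j by rewrite subr_gt0.
have l_neq0 := lt0r_neq0 l_gt0; have h_neq0 := lt0r_neq0 h_gt0.
(* [u] is the relative position of [x] in its knot interval. The preimage has the same relative
   position in the whole interval, or [1 - u] when [eps j] makes the map reverse orientation. *)
pose u := (x - t j) / (t j.+1 - t j).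
have u_ge0 : 0 <= u by rewrite divr_ge0 ?subr_ge0 // ltW.
have u_le1 : u <= 1 by rewrite ler_pdivrMr // mul1r lerD2r.
have xE : x = t j + u * (t j.+1 - t j) by rewrite /u; field.
have v01 : 0 <= (if eps j then 1 - u else u) <= 1.
  by case: (eps j); apply/andP; split; lra.
exists (t 1%N + (if eps j then 1 - u else u) * (t n - t 1%N)).
  by move: v01 => /andP[v0 v1]; apply/andP; split; nra.
rewrite {1}xE /zipper_map /slope /intercept.
by case: (eps j); rewrite ?addn1 ?subn1 ?addn0 ?subn0 /=; field.
Qed.

(** The slope is, up to sign, the length of a knot interval divided by the length of the whole
    interval that contains it. *)
Lemma norm_slope_le1 (j : nat) :
  t 1%N <= t j -> t j < t j.+1 -> t j.+1 <= t n -> `|slope n t eps j| <= 1.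
Proof.
move=> t1j tj tjn.
rewrite /slope normrM normfV (gtr0_norm (_ : 0 < t n - t 1%N)) ?subr_gt0 //.
rewrite ler_pdivrMr ?subr_gt0 // mul1r ler_norml.
by case: (eps j); rewrite ?addn1 ?subn1 ?addn0 ?subn0 /=;
  apply/andP; split; lra.
Qed.

Lemma angle_itv (x : R) :
  t 1%N <= x <= t n -> 0 <= angle n t x <= pi / 2.
Proof.
move=> /andP[x_ge x_le]; rewrite /angle.
have p_gt0 : 0 < pi / 2 :> R by rewrite divr_gt0 ?pi_gt0.
have u_ge0 : 0 <= (x - t 1%N) / (t n - t 1%N).
  by rewrite divr_ge0 ?subr_ge0 // ltW.
have u_le1 : (x - t 1%N) / (t n - t 1%N) <= 1.
  by rewrite ler_pdivrMr ?subr_gt0 // mul1r lerD2r.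
by rewrite mulr_ge0 ?(ltW p_gt0) //= ler_piMr // ltW.
Qed.

End Positivity.

(** Common form of the two middle numerator coefficients, with [p] standing for [pi], [b] for
    [beta j] or [gamma j], and [g] for the matching [f_star] or [f_star_next]. Multiplying the bound
    on [b] by [p * g] gives the positivity of the numerator over [p]. *)
Lemma shape_coef_gt0 (R : realType) (b c p g : R) :
  0 < p -> 0 < g -> - (c / (p * g)) < b -> 0 < b * g + c / p.
Proof.
move=> p_gt0 g_gt0; rewrite -mulNr ltr_pdivrMr ?mulr_gt0 // => h.
have -> : b * g + c / p = (b * (p * g) + c) / p by field; rewrite gt_eqF.
by rewrite divr_gt0 //; lra.
Qed.

Theorem theorem5 (R : realType) (n : nat) (t f d : nat -> R)
    (eps : nat -> bool) (lam alpha beta gamma delta : nat -> R)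
    (phi : R -> R)
    (n_ge3 : (3 <= n)%N)
    (t_incr : forall i : nat, (1 <= i < n)%N -> t i < t i.+1)
    (f_gt0 : forall i : nat, (1 <= i <= n)%N -> 0 < f i)
    (phi_RCTZFIF : is_RCTZFIF n t f d eps lam alpha beta gamma delta phi)
    (lam_bound : forall j : nat, (1 <= j < n)%N ->
       0 <= lam j /\
       lam j < Num.min `|slope n t eps j|
                 (Num.min (f (j + eps j)%N / f 1%N)
                          (f (j + 1 - eps j)%N / f n)))
    (shape_bound : forall j : nat, (1 <= j < n)%N ->
       let l := t n - t 1%N in
       let a := slope n t eps j in
       let f_star := f (j + eps j)%N - lam j * f 1%N in
       let f_star_next := f (j + 1 - eps j)%N - lam j * f n in
       let d_star := a * d (j + eps j)%N - lam j * d 1%N in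
       let d_star_next := a * d (j + 1 - eps j)%N - lam j * d n in
       [/\ 0 < alpha j,
           0 < delta j,
           Num.max 0 (- 2 * l * alpha j * d_star / (pi * f_star)) < beta j
         & Num.max 0 (2 * l * delta j * d_star_next / (pi * f_star_next))
             < gamma j]) :
  forall x : R, t 1%N <= x <= t n -> 0 < phi x.
Proof.
have n_gt1 : (1 < n)%N := ltnW n_ge3.
have t_le := knots_le _ _ _ t_incr.
have t_lt : t 1%N < t n.
  by apply: (lt_le_trans (t_incr 1%N _)); rewrite ?t_le ?n_gt1 ?leqnn.
have [phi_cont _ _ phi_eq] := phi_RCTZFIF.
have M_gt0 j y : (1 <= j < n)%N -> t 1%N <= y <= t n ->
    0 < rational_part n t f d eps lam alpha beta gamma delta j y.
  move=> jn /(angle_itv _ _ _ t_lt) y_angle.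
  have [_] := lam_bound j jn.
  rewrite !lt_min => /and3P[_ f1_gt0 fn_gt0].
  (* Clearing the positive denominators [f 1] and [f n] turns the two ratio bounds on [lam j] into
     the positivity of [f_star] and [f_star_next]. *)
  rewrite ltr_pdivlMr ?f_gt0 ?(ltnW n_gt1) // -subr_gt0 in f1_gt0.
  rewrite ltr_pdivlMr ?f_gt0 ?(ltnW n_gt1) ?leqnn // -subr_gt0 in fn_gt0.
  have [a_gt0 d_gt0] := shape_bound j jn.
  rewrite !gt_max !mulNr => /andP[b_gt0 hb] /andP[g_gt0 hg].
  have U_gt0 : 0 < U_coef f eps lam alpha j by apply: mulr_gt0.
  have X_gt0 : 0 < X_coef n f eps lam delta j by apply: mulr_gt0.
  have V_gt0 : 0 < V_coef n t f d eps lam alpha beta j.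
    by apply: shape_coef_gt0; rewrite ?pi_gt0.
  have W_gt0 : 0 < W_coef n t f d eps lam gamma delta j.
    (* The derivative term enters [W_coef] with a minus sign, so the lemma is used with a negated
       [c]; the two negations then cancel in the bound on [gamma j]. *)
    rewrite /W_coef -[X in _ + X]mulNr.
    apply: shape_coef_gt0; rewrite ?pi_gt0 //.
    by rewrite mulNr opprK.
  by rewrite /rational_part divr_gt0 // trig_cubic_gt0.
have [x0 x0_itv x0_min] := EVT_min (ltW t_lt) phi_cont.
suff phi_x0 : 0 < phi x0.
  by move=> x x_itv; apply: (lt_le_trans phi_x0); apply: x0_min; rewrite in_itv.
rewrite in_itv /= in x0_itv.
have [j jn x0j] := knot_interval _ _ _ _ n_gt1 x0_itv.
have /andP[j_ge1 j_ltn] := jn.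
have tj := t_incr j jn.
have [y y_itv x0E] := zipper_map_onto _ _ _ eps t_lt _ _ tj x0j.
have phi_x0E := phi_eq j y jn y_itv; rewrite -x0E in phi_x0E.
have phi_le : phi x0 <= phi y by apply: x0_min; rewrite in_itv.
have M_y := M_gt0 j y jn y_itv.
have [lam_ge0] := lam_bound j jn; rewrite lt_min => /andP[lam_lt _].
have lam_lt1 : lam j < 1.
  apply: (lt_le_trans lam_lt).
  apply: norm_slope_le1 => //; apply: t_le => //.
    by rewrite j_ge1 ltnW.
  by rewrite j_ltn leqnn.
(* Minimality survives multiplication because [lam j] is nonnegative. Inserted in the functional
   equation it gives [(1 - lam j) * phi x0 > 0], where the first factor is positive. *)
have : lam j * phi x0 <= lam j * phi y by rewrite ler_wpM2l.
nra.
Qed.
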